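(* Let $d+1=2^t$ for some integer $t\ge 2$. Then, for every $\epsilon>0$, there exists $n_0$ such that for every $n\ge n_0$ the following hold: 1. $\delta_d(S_{d+1,n})\ge \frac12-\epsilon$. 2. $\mathrm{Rej}_{d,d+1}(S_{d+1,n})\le \frac12-2^{-7}+\epsilon$.
   Context: For positive integers $m\le n$, $S_{m,n}:\mathbb{F}_2^n\to\mathbb{F}_2$ is the elementary symmetric polynomial $S_{m,n}(x_1,\dots,x_n)=\sum_{I\subseteq[n],\,|I|=m}\prod_{i\in I}x_i$. Every function $f:\mathbb{F}_2^n\to\mathbb{F}_2$ is uniquely a multilinear polynomial over $\mathbb{F}_2$; $\deg f$ is its degree. $\delta_d(f)=\min\{\Pr_{x\in\mathbb{F}_2^n}[f(x)\ne g(x)] : g:\mathbb{F}_2^n\to\mathbb{F}_2,\ \deg g\le d\}$, with $x$ uniform. $\mathrm{Rej}_{d,k}(f)$ is the probability that $f|_A$ is not of degree at most $d$ when $A$ is a uniformly random $k$-dimensional affine subspace of $\mathbb{F}_2^n$ (the restriction is viewed as a function on $\mathbb{F}_2^k$ via any affine parametrization of $A$). *)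

(* Defs.v *)
From mathcomp Require Import all_boot all_order all_algebra.
From mathcomp Require Import reals.

Set Implicit Arguments.
Unset Strict Implicit.
Unset Printing Implicit Defensive.

Import Order.TTheory GRing.Theory Num.Theory.
Local Open Scope ring_scope.

Notation boolfun n := {ffun 'rV['F_2]_n -> 'F_2}.

(* A multilinear polynomial is encoded by its coefficients: the subset I of
   the variables stands for the monomial \prod_(i in I) x_i. *)
Notation mlpoly n := {ffun {set 'I_n} -> 'F_2}.

Definition mleval n (c : mlpoly n) : boolfun n :=
  [ffun x : 'rV['F_2]_n => \sum_(I : {set 'I_n}) c I * \prod_(i in I) x 0 i].

Lemma mleval_inj n : injective (@mleval n).
Proof.
move=> c c' /ffunP eqcc'; apply/ffunP => I.
elim: {I}_.+1 {-2}I (ltnSn #|I|) => // k IHk I ltIk.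
have /= := eqcc' (\row_i (i \in I)%:R); rewrite !ffunE.
have prodE (J : {set 'I_n}) :
    \prod_(i in J) (\row_i (i \in I)%:R : 'rV['F_2]_n) 0 i = (J \subset I)%:R.
  have [sJI | /subsetPn[i iJ iI]] := boolP (J \subset I).
    by rewrite big1 // => i /(subsetP sJI) iI; rewrite mxE iI.
  by rewrite (bigD1 i) //= mxE (negbTE iI) mul0r.
rewrite (bigD1 I) // [in RHS](bigD1 I) //= prodE subxx !mulr1.
suff /eqP-> : \sum_(J | J != I) c J * \prod_(i in J) (\row_i (i \in I)%:R) 0 i
    == \sum_(J | J != I) c' J * \prod_(i in J) (\row_i (i \in I)%:R) 0 i.
  exact: addIr.
apply/eqP/eq_bigr => J neJI; rewrite prodE.
have [sJI|_] := boolP (J \subset I); last by rewrite !mulr0.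
rewrite IHk //; apply: leq_trans (proper_card _) ltIk.
by rewrite properEneq neJI.
Qed.

Lemma mleval_surj n (f : boolfun n) : exists c : mlpoly n, mleval c == f.
Proof.
have [|g _ gK] := inj_card_bij (@mleval_inj n); last by exists (g f); rewrite gK.
rewrite !card_ffun card_mx mul1n card_Fp // -[#|{set _}|]cardsT.
by rewrite -powersetT card_powerset cardsT card_ord.
Qed.

Definition mlrep n (f : boolfun n) : mlpoly n := xchoose (mleval_surj f).

(* The zero function gets degree 0. *)
Definition deg n (f : boolfun n) : nat :=
  \max_(I : {set 'I_n} | mlrep f I != 0) #|I|.

Definition elsym m n : boolfun n :=
  [ffun x : 'rV['F_2]_n =>
     \sum_(I : {set 'I_n} | #|I| == m) \prod_(i in I) x 0 i].

(* Probability that a uniformly random element of A lies in E. *)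
Definition Pr (R : realType) (T : finType) (A E : {set T}) : R :=
  #|A :&: E|%:R / #|A|%:R.

(* The set of competitors contains 0, and probabilities are at most 1, so the
   default value 1 never affects the minimum. *)
Definition delta (R : realType) (d n : nat) (f : boolfun n) : R :=
  \big[Num.min/1]_(g : boolfun n | (deg g <= d)%N)
    Pr R [set: 'rV['F_2]_n] [set x | f x != g x].

(* The pair p = (b, M) stands for the map y |-> b + y M from F_2^k to F_2^n. *)
Definition affmap k n (p : 'rV['F_2]_n * 'M['F_2]_(k, n)) (y : 'rV['F_2]_k) :
    'rV['F_2]_n :=
  p.1 + y *m p.2.

(* row_free p.2 makes the linear part injective, so the image has
   dimension exactly k. *)
Definition parametrizes k n (p : 'rV['F_2]_n * 'M['F_2]_(k, n))
    (A : {set 'rV['F_2]_n}) : bool :=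
  row_free p.2 && (A == [set affmap p y | y : 'rV['F_2]_k]).

Definition affine_subspaces k n : {set {set 'rV['F_2]_n}} :=
  [set A | [exists p : 'rV['F_2]_n * 'M['F_2]_(k, n), parametrizes p A]].

(* The degree of the restriction does not depend on the parametrization. *)
Definition restr_deg_le k n (f : boolfun n) (A : {set 'rV['F_2]_n}) (d : nat) :
    bool :=
  [forall p : 'rV['F_2]_n * 'M['F_2]_(k, n),
    parametrizes p A ==> (deg [ffun y => f (affmap p y)] <= d)%N].

Definition Rej (R : realType) (d k n : nat) (f : boolfun n) : R :=
  Pr R (affine_subspaces k n) [set A | ~~ restr_deg_le k f A d].

(* Main.v *)
Require Import Defs.
From mathcomp Require Import all_boot all_order all_fingroup all_algebra.
From mathcomp Require Import reals.
From mathcomp Require Import zify ring lra.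

(* Put q = d + 1 = 2^t.

   Distance.  On a point x the polynomial S_q takes the value of the bit of
   weight q of |x|, so phi w = (-1)^C(w, q) satisfies phi (w + q) = - phi w.
   Such signs are uncorrelated with every polynomial of degree < q: by Ramsey's
   theorem (in the style of Alon and Beigel) a large set H of variables has all
   its top-degree coefficients equal, whatever values are given to the variables
   outside H.  On each subcube with free variables H the top-degree part is a
   multiple of S_k with k < q, a q-periodic function of the weight, which can be
   absorbed into phi, and the degree drops.  In degree 0, a set of q variables
   being all 0 or all 1 gives opposite signs, so averaging over q variables
   contracts by the factor 1 - 2^(1-q).

   Rejection.  The sum of S_q over the subspace b + rowspan M is the sum over
   q-subsets I of columns of det M_I (the number of y with y M_I = c is odd iff
   M_I is invertible), that is, det (M M^T) by Cauchy-Binet, squares being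
   trivial in F_2.  This Gram determinant is additive in each row.  Write
   M = (N; y; x).  With probability at least 1/2, N has a singular Gram matrix;
   then two linear conditions on y make the Gram matrix of (N; y) have corank 2,
   so that no x makes it invertible; otherwise additivity in x gives at most 1/2.
   Hence det (M M^T) = 1 with probability at most (1/2)(1 - 1/8) = 7/16. *)

Set Implicit Arguments.
Unset Strict Implicit.
Unset Printing Implicit Defensive.

Import Order.TTheory GRing.Theory Num.Theory.
Local Open Scope ring_scope.

(** * Ramsey's theorem *)

(** Induction on [k]. For [k.+1], separate targets [m1] and [m2] for the two colours allow an inner
    induction on their sum: a point [a] is removed, [k]-sets [I] are coloured by [c (a |: I)], and
    inside a homogeneous [H] the target of the colour found is lowered by one, as [a] supplies the
    missing element. *)
Lemma ramsey k m : exists N, forall (T : finType) (J : {set T})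
    (c : {set T} -> bool), (N <= #|J|)%N ->
  exists (H : {set T}) (b : bool), [/\ H \subset J, (m <= #|H|)%N &
    forall I : {set T}, I \subset H -> #|I| = k -> c I = b].
Proof.
elim: k m => [|k IHk] m.
  exists m => T J c leJ; exists J, (c set0); split=> // I _ /eqP.
  by rewrite cards_eq0 => /eqP ->.
suff H2 s : forall m1 m2, (m1 + m2 <= s)%N -> exists N, forall (T : finType)
    (J : {set T}) (c : {set T} -> bool), (N <= #|J|)%N ->
    exists (H : {set T}) (b : bool), [/\ H \subset J,
      ((if b then m1 else m2) <= #|H|)%N &
      forall I : {set T}, I \subset H -> #|I| = k.+1 -> c I = b].
  have [N HN] := H2 _ m m (leqnn _); exists N => T J c /HN -/(_ c)[H [b []]].
  by rewrite if_same; exists H, b.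
elim: s => [|s IHs] m1 m2 les.
  exists 0%N => T J c _; exists set0, true; split; rewrite ?sub0set ?cards0 //.
    by lia.
  by move=> I; rewrite subset0 => /eqP ->; rewrite cards0.
have [m1_0|m1_gt0] := posnP m1.
  exists 0%N => T J c _; exists set0, true; split; rewrite ?sub0set ?cards0 //.
    by lia.
  by move=> I; rewrite subset0 => /eqP ->; rewrite cards0.
have [m2_0|m2_gt0] := posnP m2.
  exists 0%N => T J c _; exists set0, false; split; rewrite ?sub0set ?cards0 //.
    by lia.
  by move=> I; rewrite subset0 => /eqP ->; rewrite cards0.
have [|N1 HN1] := IHs m1.-1 m2; first by lia.
have [|N2 HN2] := IHs m1 m2.-1; first by lia.
have [N HN] := IHk (maxn N1 N2).
exists N.+1 => T J c leJ.
have [a aJ] : exists a, a \in J by apply/card_gt0P; lia.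
have [|H [b [sHJ leH Hc]]] := HN T (J :\ a) (fun I => c (a |: I)).
  by have := cardsD1 a J; rewrite aJ; lia.
have aH : a \notin H.
  by apply/negP => /(subsetP sHJ); rewrite !inE eqxx.
have ext (H' : {set T}) : H' \subset H ->
    (forall I : {set T}, I \subset H' -> #|I| = k.+1 -> c I = b) ->
    [/\ a |: H' \subset J, #|a |: H'| = #|H'|.+1 & forall I : {set T},
      I \subset a |: H' -> #|I| = k.+1 -> c I = b].
  move=> sH' cH'; split.
  - rewrite subUset sub1set aJ (subset_trans (subset_trans sH' sHJ)) //.
    exact: subD1set.
  - by rewrite cardsU1 (contra (subsetP sH' a)).
  - move=> I sI cI; have [aI|aI] := boolP (a \in I); last first.
      apply: cH' => //; apply/subsetP => x xI; have := subsetP sI x xI.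
      by rewrite !inE => /predU1P[xa|//]; rewrite xa (negbTE aI) in xI.
    rewrite -(setD1K aI); apply: Hc.
      apply/subsetP => x; rewrite !inE => /andP[xa xI].
      have := subsetP sI x xI.
      by rewrite !inE (negbTE xa) /= => /(subsetP sH').
    by have := cardsD1 a I; rewrite aI cI; lia.
have sHJ' : H \subset J by apply: subset_trans sHJ (subD1set _ _).
case: b Hc ext => Hc ext.
- have [|H' [b' [sH' leH' Hc']]] := HN1 T H c; first by lia.
  case: b' leH' Hc' => leH' Hc'.
  + have [? cH ?] := ext H' sH' Hc'.
    by exists (a |: H'), true; split=> //; lia.
  + by exists H', false; split=> //; apply: subset_trans sH' sHJ'.
- have [|H' [b' [sH' leH' Hc']]] := HN2 T H c; first by lia.
  case: b' leH' Hc' => leH' Hc'.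
  + by exists H', true; split=> //; apply: subset_trans sH' sHJ'.
  + have [? cH ?] := ext H' sH' Hc'.
    by exists (a |: H'), false; split=> //; lia.
Qed.

(** * Sums over subsets and parity of binomial coefficients *)

Lemma sum_subset_split (V : nmodType) (T : finType) (J H : {set T})
    (F : {set T} -> V) : H \subset J ->
  \sum_(Y : {set T} | Y \subset J) F Y =
  \sum_(Z : {set T} | Z \subset J :\: H)
    \sum_(Y : {set T} | Y \subset H) F (Y :|: Z).
Proof.
move=> sHJ; rewrite pair_big /=.
rewrite (reindex_onto (fun p : {set T} * {set T} => p.2 :|: p.1)
  (fun X => (X :\: H, X :&: H))) /=; last by move=> X _; rewrite setID.
apply: eq_bigl => -[Z Y] /=; apply/andP/andP => [[sYZ /eqP[eqZ eqY]]|[sZ sY]].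
  by rewrite -{1}eqZ -{2}eqY setSD // subsetIr.
have dZH : [disjoint Z & H].
  by rewrite (disjointWl sZ) // disjoints_subset setDE subsetIr.
split; first by rewrite subUset (subset_trans sY) // (subset_trans sZ) ?subsetDl.
apply/eqP; congr pair.
  rewrite setDUl (setDidPl dZH); move: sY; rewrite -setD_eq0 => /eqP ->.
  by rewrite set0U.
by rewrite setIUl (setIidPl sY) (disjoint_setI0 dZH) setU0.
Qed.

(** Absorption: [j * 'C(2^t, j)] is a multiple of [2^t], and an odd binomial is coprime to [2^t],
    which must then divide [j]. *)
Lemma odd_bin_pow2 t j : odd 'C(2 ^ t, j) -> (j == 0%N) || (j == 2 ^ t)%N.
Proof.
case: j => // j oC; have /esym dC := mul_bin_diag (2 ^ t) j.
have : (2 ^ t %| j.+1)%N.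
  rewrite -(@Gauss_dvdl _ _ 'C(2 ^ t, j.+1)) ?coprimeXl ?coprime2n //.
  by rewrite dC dvdn_mulr.
move=> /dvdn_leq leq2; have [gtj|] := ltnP (2 ^ t)%N j.+1.
  by rewrite bin_small in oC.
by move=> lej; apply/orP; right; rewrite eqn_leq lej leq2.
Qed.

(** In Vandermonde's sum of ['C(2^t, i) * 'C(w, k - i)] only [i = 0] and [i = 2^t] can give an odd
    first factor, and the latter index occurs only for [k = 2^t]. *)
Lemma odd_bin_add_pow2 t w k : (k <= 2 ^ t)%N ->
  odd 'C(w + 2 ^ t, k) = odd 'C(w, k) (+) (k == 2 ^ t)%N.
Proof.
have even_sum (I : finType) (F : I -> nat) :
    (forall i, ~~ odd (F i)) -> odd (\sum_i F i) = false.
  move=> evF; apply/negbTE; elim/big_ind: _ => // x y /negbTE ox /negbTE oy.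
  by rewrite oddD ox oy.
move=> lek; rewrite addnC -binomial.Vandermonde big_ord_recl /= bin0 mul1n subn0 oddD.
congr addb; case: eqVneq => [kq|neqk].
  case: k lek kq => [|k] lek kq; first by have := expn_gt0 2 t; rewrite -kq.
  rewrite big_ord_recr /= oddD even_sum => [|i].
    by rewrite /bump /= add1n subnn bin0 -kq binn.
  rewrite oddM negb_and; apply/orP; left; apply/negP => /odd_bin_pow2.
  by rewrite /bump /=; have := ltn_ord i; lia.
apply: even_sum => i.
rewrite oddM negb_and; apply/orP; left; apply/negP => /odd_bin_pow2.
by rewrite /bump /=; have := ltn_ord i; lia.
Qed.

(** * Antiperiodic functions of the weight *)

Lemma F2_cases (a : 'F_2) : a = 0 \/ a = 1.
Proof. by case: a => -[|[|//]] lt2; [left | right]; apply: val_inj. Qed.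

Definition sgnF2 (R : pzRingType) (a : 'F_2) : R := (-1) ^+ (a != 0).

Lemma sgnF2D (R : pzRingType) a b : sgnF2 R (a + b) = sgnF2 R a * sgnF2 R b.
Proof.
rewrite /sgnF2 -signr_addb; congr (_ ^+ nat_of_bool _).
by case: (F2_cases a) => ->; case: (F2_cases b) => ->.
Qed.

Definition antiperiodic (R : numDomainType) (q : nat) (phi : nat -> R) : Prop :=
  forall w, `|phi w| <= 1 /\ phi (w + q)%N = - phi w.

Lemma antiperiodic_shift (R : numDomainType) q (phi : nat -> R) s :
  antiperiodic q phi -> antiperiodic q (fun w => phi (w + s)%N).
Proof. by move=> ap w; rewrite addnAC; apply: ap. Qed.

Lemma subset_of_card (T : finType) (J : {set T}) q : (q <= #|J|)%N ->
  exists2 H : {set T}, H \subset J & #|H| = q.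
Proof.
move=> leq; exists [set x in take q (enum J)].
  by apply/subsetP => x; rewrite inE => /mem_take; rewrite mem_enum.
rewrite cardsE (card_uniqP _) ?take_uniq ?enum_uniq // size_takel //.
by rewrite -cardE.
Qed.

Lemma card_subsets (T : finType) (J : {set T}) :
  #|[pred Y : {set T} | Y \subset J]| = (2 ^ #|J|)%N.
Proof. by rewrite -card_powerset -cardsE; apply: eq_card => Y; rewrite !inE. Qed.

Lemma disjoint_card_setU (T : finType) (J H Y Z : {set T}) :
  Y \subset H -> Z \subset J :\: H -> #|Y :|: Z| = (#|Y| + #|Z|)%N.
Proof.
move=> sYH sZ; rewrite cardsU (_ : Y :&: Z = set0) ?cards0 ?subn0 //.
apply: disjoint_setI0; rewrite (disjointWl sYH) // disjoint_sym.
by rewrite (disjointWl sZ) // disjoints_subset setDE subsetIr.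
Qed.

(** Fix [q] elements [H] of [J]. The choices [Y = set0] and [Y = H] cancel for every [Z] outside
    [H]; each of the [2^q - 2] others leaves a sum over [J :\: H] of a shift of [phi], to which
    induction on [a] applies. *)
Lemma antiperiodic_sum_le (R : numFieldType) (q a : nat) (T : finType)
    (J : {set T}) (phi : nat -> R) :
  (0 < q)%N -> antiperiodic q phi -> (q * a <= #|J|)%N ->
  `|\sum_(Y : {set T} | Y \subset J) phi #|Y| | <=
    (2 ^ q - 2)%N%:R ^+ a * 2 ^+ (#|J| - q * a).
Proof.
move=> q_gt0; elim: a => [|a IHa] in J phi *; move=> ap leJ.
  rewrite muln0 subn0 expr0 mul1r; apply: le_trans (ler_norm_sum _ _ _) _.
  have B (Y : {set T}) : Y \subset J -> `|phi #|Y| | <= 1.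
    by move=> _; case: (ap #|Y|).
  by apply: le_trans (ler_sum _ B) _; rewrite sumr_const card_subsets -natrX.
have [|H sHJ cH] := @subset_of_card _ J q; first by nia.
have cJH : #|J :\: H| = (#|J| - q)%N by rewrite cardsD (setIidPr sHJ) cH.
rewrite (sum_subset_split _ sHJ) exchange_big /=.
have E (Y : {set T}) : Y \subset H ->
    \sum_(Z : {set T} | Z \subset J :\: H) phi #|Y :|: Z| =
    \sum_(Z : {set T} | Z \subset J :\: H) phi (#|Z| + #|Y|)%N.
  by move=> sY; apply: eq_bigr => Z sZ; rewrite (disjoint_card_setU sY sZ) addnC.
have s0 : (set0 \subset H) && (set0 != H).
  by rewrite sub0set /=; apply: contraTneq q_gt0 => eH; rewrite -cH -eH cards0.
rewrite (eq_bigr _ E) (bigD1 H) ?subxx //= [X in _ + X](bigD1 set0 s0) /=.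
rewrite addrA [X in X + _](_ : _ = 0) ?add0r; last first.
  by rewrite cards0 cH -big_split big1 // => Z _ /=; rewrite (ap #|Z|).2 addn0 addNr.
apply: le_trans (ler_norm_sum _ _ _) _.
have B (Y : {set T}) : (Y \subset H) && (Y != H) && (Y != set0) ->
    `|\sum_(Z : {set T} | Z \subset J :\: H) phi (#|Z| + #|Y|)%N| <=
    (2 ^ q - 2)%N%:R ^+ a * 2 ^+ (#|J| - q * a.+1).
  move=> _; apply: le_trans (IHa _ _ (antiperiodic_shift #|Y| ap) _) _.
    by rewrite cJH; nia.
  by rewrite cJH mulnS subnDA.
apply: le_trans (ler_sum _ B) _.
have cI : #|[pred Y : {set T} | (Y \subset H) && (Y != H) && (Y != set0)]| =
    (2 ^ q - 2)%N.
  have := cardD1 H [pred Y : {set T} | Y \subset H].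
  rewrite inE subxx card_subsets cH.
  have := cardD1 set0 [predD1 [pred Y : {set T} | Y \subset H] & H].
  rewrite !inE andbC s0 => eq2 eq1; rewrite eq1 eq2 !add1n !subSS subn0.
  by apply: eq_card => Y; rewrite !inE -andbA andbC andbCA andbA.
by rewrite sumr_const cI exprS -mulrA mulr_natl.
Qed.

Lemma antiperiodic_sum_small (R : realType) (q : nat) (eps : R) :
  (0 < q)%N -> 0 < eps -> exists N, forall (T : finType) (J : {set T})
    (phi : nat -> R), antiperiodic q phi -> (N <= #|J|)%N ->
  `|\sum_(Y : {set T} | Y \subset J) phi #|Y| | <= eps * 2 ^+ #|J|.
Proof.
move=> q_gt0 eps_gt0.
have q2 : (2 <= 2 ^ q)%N by rewrite -{1}(expn1 2) leq_exp2l.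
pose r : R := (2 ^ q - 2)%N%:R / 2 ^+ q.
have r_ge0 : 0 <= r by rewrite divr_ge0 ?exprn_ge0 ?ler0n.
have r_lt1 : r < 1.
  rewrite ltr_pdivrMr ?exprn_gt0 ?ltr0n // mul1r -natrX ltr_nat; lia.
(* The contraction factor [r] is 0 when [q = 1]; otherwise Bernoulli's inequality for [r^-1 = 1 + b]
   provides [a]. *)
have [a ra] : exists a, r ^+ a <= eps.
  have [r0|r_neq0] := eqVneq r 0; first by exists 1%N; rewrite expr1 r0 ltW.
  have r_gt0 : 0 < r by rewrite lt_def r_neq0.
  pose b := r^-1 - 1; have b_gt0 : 0 < b.
    by rewrite subr_gt0 invf_gt1.
  pose a := Num.bound (eps^-1 / b); exists a.
  have bern n : 1 + n%:R * b <= r^-1 ^+ n.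
    elim: n => [|n IHn]; first by rewrite mul0r addr0 expr0.
    rewrite exprS (_ : r^-1 = 1 + b); last by rewrite /b; ring.
    rewrite (_ : r^-1 = 1 + b) in IHn; last by rewrite /b; ring.
    have := @ler_wpM2l R (1 + b) _ _ _ IHn; rewrite -natr1.
    have : 0 <= n%:R * b * b by rewrite !mulr_ge0 ?ler0n ?ltW.
    by move=> ? /(_ (ltW (ltr_wpDl ler01 b_gt0))); nra.
  rewrite -lef_pV2 ?posrE ?exprn_gt0 // -exprVn.
  apply: le_trans (bern a); have : eps^-1 / b < a%:R.
    by apply: archi_boundP; rewrite divr_ge0 ?invr_ge0 ?ltW.
  by rewrite ltr_pdivrMr // => lt1; rewrite ler_wpDl // ltW.
exists (q * a)%N => T J phi ap leJ.
apply: le_trans (antiperiodic_sum_le q_gt0 ap leJ) _.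
apply: le_trans (ler_wpM2r _ ra); last by rewrite exprn_ge0.
have -> : 2 ^+ #|J| = 2 ^+ (#|J| - q * a) * 2 ^+ (q * a) :> R.
  by rewrite -exprD subnK.
by rewrite expr_div_n -exprM mulrA mulrAC divfK ?expf_neq0 ?pnatr_eq0.
Qed.

(** For [k < 2^t] the parity of ['C(w, k)] is [2^t]-periodic in [w]; this is how a symmetric
    top-degree part is absorbed into [phi]. *)
Lemma antiperiodic_mul_bin (R : numDomainType) t k (b : bool) (phi : nat -> R) :
  (k < 2 ^ t)%N -> antiperiodic (2 ^ t) phi ->
  antiperiodic (2 ^ t) (fun w => phi w * (-1) ^+ (b && odd 'C(w, k))).
Proof.
move=> ltk ap w; rewrite normrM normr_sign mulr1; split; first exact: (ap w).1.
by rewrite (ap w).2 odd_bin_add_pow2 1?ltnW // (ltn_eqF ltk) addbF mulNr.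
Qed.

Lemma card_ksubsets (T : finType) (Y : {set T}) k :
  #|[pred I : {set T} | (I \subset Y) && (#|I| == k)]| = 'C(#|Y|, k).
Proof.
by rewrite -(@cards_draws T Y k) -cardsE; apply: eq_card => I; rewrite !inE.
Qed.

(** Here [c] lists the coefficients of a polynomial of degree less than [k], evaluated at the
    indicator of [Y]. Induction on [k]; [N] is uniform in [phi] and [c] because both change from one
    subcube to the next. *)
Lemma antiperiodic_poly_sum_small (R : realType) (t k : nat) (eps : R) :
  (k <= 2 ^ t)%N -> 0 < eps -> exists N, forall (T : finType) (J : {set T})
    (phi : nat -> R) (c : {set T} -> 'F_2),
  antiperiodic (2 ^ t) phi -> (forall I : {set T}, (k <= #|I|)%N -> c I = 0) ->
  (N <= #|J|)%N ->
  `|\sum_(Y : {set T} | Y \subset J)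
      phi #|Y| * sgnF2 R (\sum_(I : {set T} | I \subset Y) c I)|
    <= eps * 2 ^+ #|J|.
Proof.
move=> lek eps_gt0; elim: k lek => [|k IHk] ltk.
  have q_gt0 : (0 < 2 ^ t)%N by rewrite expn_gt0.
  have [N HN] := antiperiodic_sum_small q_gt0 eps_gt0.
  exists N => T J phi c ap c0 leJ; apply: le_trans (HN T J phi ap leJ).
  rewrite le_eqVlt; apply/orP; left; apply/eqP; congr `|_|.
  apply: eq_bigr => Y _; rewrite big1 => [|I _]; last exact: c0.
  by rewrite /sgnF2 eqxx mulr1.
have [N HN] := IHk (ltnW ltk); have [Nr HNr] := ramsey k N.
exists Nr => T J phi c ap c0 leJ.
have [H [b [sHJ leH Hc]]] := HNr T J (fun I => c I != 0) leJ.
rewrite (sum_subset_split _ sHJ).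
apply: le_trans (ler_norm_sum _ _ _) _.
suff B (Z : {set T}) : Z \subset J :\: H ->
    `|\sum_(Y : {set T} | Y \subset H) phi #|Y :|: Z| *
       sgnF2 R (\sum_(I : {set T} | I \subset Y :|: Z) c I)| <= eps * 2 ^+ #|H|.
  apply: le_trans (ler_sum _ B) _.
  rewrite sumr_const card_subsets -[X in X <= _]mulr_natr.
  by rewrite -mulrA natrX -exprD cardsD (setIidPr sHJ) subnKC // subset_leq_card.
move=> sZ.
(* Coefficient of [I] on the subcube where the variables in [Z] are 1 and the others of [J :\: H]
   are 0. In [c'] the degree [k] part is dropped; it moves into [phi']. *)
pose cZ (I : {set T}) := \sum_(I' : {set T} | I' \subset Z) c (I :|: I').
pose c' (I : {set T}) := if (#|I| < k)%N then cZ I else 0.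
pose phi' w := phi (w + #|Z|)%N * (-1) ^+ (b && odd 'C(w, k)).
have ap' : antiperiodic (2 ^ t) phi'.
  exact/antiperiodic_mul_bin/antiperiodic_shift.
have c'0 (I : {set T}) : (k <= #|I|)%N -> c' I = 0.
  by rewrite /c' ltnNge => ->.
apply: le_trans (HN T H phi' c' ap' c'0 leH).
rewrite le_eqVlt; apply/orP; left; apply/eqP; congr `|_|.
apply: eq_bigr => Y sY; rewrite (disjoint_card_setU sY sZ) /phi' -mulrA.
congr (_ * _).
have -> : \sum_(I : {set T} | I \subset Y :|: Z) c I =
    \sum_(I : {set T} | I \subset Y) cZ I.
  rewrite (sum_subset_split _ (subsetUl Y Z)) exchange_big /=.
  apply: eq_bigr => I _; apply: eq_bigl => I'; congr (I' \subset pred_of_set _).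
  apply/setP => x; rewrite !inE; have := subsetP sZ x; rewrite !inE.
  by case: (boolP (x \in Y)) => [/(subsetP sY) ->|] //=; case: (x \in Z) => // /(_ isT).
have -> : (-1) ^+ (b && odd 'C(#|Y|, k)) = sgnF2 R (b%:R * 'C(#|Y|, k)%:R).
  rewrite /sgnF2; congr (_ ^+ nat_of_bool _); case: (b); rewrite ?mul0r //= mul1r.
  by rewrite -(dvdn_pcharf (pchar_Fp (isT : prime 2))) dvdn2 negbK.
rewrite -sgnF2D; congr sgnF2.
rewrite (bigID (fun I : {set T} => #|I| == k)) /=; congr (_ + _).
  rewrite (eq_bigr (fun=> b%:R)) => [|I /andP[sI /eqP cI]].
    by rewrite sumr_const card_ksubsets mulr_natr.
  (* Since [c] vanishes above size [k], only [I' = set0] counts: the degree [k] coefficients are the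
     same for every [Z]. *)
  rewrite /cZ (bigD1 set0) ?sub0set //= setU0 big1 ?addr0.
    have := Hc I (subset_trans sI sY) cI; case: (F2_cases (c I)) => -> <- //.
  move=> I' /andP[sI' I'0]; apply: c0.
  rewrite (@disjoint_card_setU _ J H) ?(subset_trans sI) ?(subset_trans sI') //.
  by rewrite cI -addn1 leq_add2l card_gt0.
rewrite [RHS](bigID (fun I : {set T} => #|I| == k)) /= [X in _ = X + _]big1 ?add0r.
  apply: eq_bigr => I /andP[sI cI]; rewrite /c'; case: ltnP => // lekI.
  rewrite /cZ big1 // => I' sI'; apply: c0.
  apply: leq_trans (subset_leq_card (subsetUl _ _)).
  by rewrite ltn_neqAle eq_sym cI.
by move=> I /andP[_ /eqP cI]; apply: c'0; rewrite cI.
Qed.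

(** * Distance to low degree *)

Definition supp n (x : 'rV['F_2]_n) : {set 'I_n} := [set i | x 0 i != 0].

Definition charvec n (X : {set 'I_n}) : 'rV['F_2]_n := \row_i (i \in X)%:R.

Lemma charvecK n : cancel (@charvec n) (@supp n).
Proof. by move=> X; apply/setP => i; rewrite !inE mxE; case: (i \in X). Qed.

Lemma suppK n : cancel (@supp n) (@charvec n).
Proof.
move=> x; apply/rowP => i; rewrite mxE inE.
by case: (F2_cases (x 0 i)) => ->.
Qed.

Lemma prod_suppE n (x : 'rV['F_2]_n) (I : {set 'I_n}) :
  \prod_(i in I) x 0 i = (I \subset supp x)%:R.
Proof.
have [/subsetP sI | /subsetPn[i iI]] := boolP (I \subset supp x).
  rewrite big1 // => i /sI; rewrite inE.
  by case: (F2_cases (x 0 i)) => -> //; rewrite eqxx.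
by rewrite inE negbK (bigD1 i) //= => /eqP ->; rewrite mul0r.
Qed.

Lemma mleval_supp n (c : mlpoly n) x :
  mleval c x = \sum_(I : {set 'I_n} | I \subset supp x) c I.
Proof.
rewrite ffunE [RHS]big_mkcond; apply: eq_bigr => I _; rewrite prod_suppE.
by case: ifP; rewrite ?mulr1 ?mulr0.
Qed.

Lemma elsym_supp m n (x : 'rV['F_2]_n) : elsym m n x = 'C(#|supp x|, m)%:R.
Proof.
rewrite ffunE -card_ksubsets -sum1_card natr_sum big_mkcond [RHS]big_mkcond /=.
apply: eq_bigr => I _; rewrite prod_suppE inE.
by case: eqP; case: (I \subset _).
Qed.

Lemma mleval_mlrep n (f : boolfun n) : mleval (mlrep f) = f.
Proof. exact/eqP/(xchooseP (mleval_surj f)). Qed.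

Lemma deg_leP n (f : boolfun n) d : (deg f <= d)%N ->
  forall I : {set 'I_n}, (d < #|I|)%N -> mlrep f I = 0.
Proof.
move=> degf I ltI; apply/eqP; apply: contraTT ltI => nz; rewrite -leqNgt.
by apply: leq_trans degf; apply: leq_bigmax_cond.
Qed.

Lemma card_rV_F2 n : #|{: 'rV['F_2]_n}| = (2 ^ n)%N.
Proof. by rewrite card_mx mul1n card_Fp. Qed.

(** Translates correlation into distance: a small correlation means a distance near 1/2. *)
Lemma sum_sgnF2D (R : pzRingType) n (f g : boolfun n) :
  \sum_x sgnF2 R (f x + g x) = (2 ^ n)%N%:R - 2 * #|[set x | f x != g x]|%:R.
Proof.
have E x : sgnF2 R (f x + g x) = 1 - 2 * (f x != g x)%:R.
  rewrite /sgnF2; case: (F2_cases (f x)) => ->; case: (F2_cases (g x)) => -> /=;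
  by rewrite ?expr0 ?expr1 ?mulr0 ?subr0 // mulr1 -[2]/(1 + 1) opprD addNKr.
rewrite (eq_bigr _ (fun x _ => E x)) sumrB sumr_const -card_rV_F2; congr (_ - _).
rewrite -mulr_sumr -sum1_card natr_sum [in RHS]big_mkcond /=; congr (_ * _).
by apply: eq_bigr => x _; rewrite inE; case: ifP.
Qed.

Lemma delta_elsym_ge (R : realType) (t d : nat) (eps : R) :
  (d < 2 ^ t)%N -> 0 < eps -> exists N, forall n, (N <= n)%N ->
  1 / 2 - eps <= delta R d (elsym (2 ^ t)%N n).
Proof.
move=> ltd eps_gt0.
have [N HN] := @antiperiodic_poly_sum_small R t _ eps (leqnn _) eps_gt0.
(* The goal closed first compares with the default value 1 of the minimum. *)
exists N => n leN; apply: le_bigmin => [|g degg]; first by lra.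
pose phi w : R := (-1) ^+ odd 'C(w, 2 ^ t).
have ap : antiperiodic (2 ^ t) phi.
  move=> w; rewrite /phi normr_sign; split=> //.
  by rewrite odd_bin_add_pow2 // eqxx addbT signrN.
have := HN _ [set: 'I_n] phi (mlrep g) ap.
rewrite cardsT card_ord => /(_ _ leN) /=.
have c0 (I : {set 'I_n}) : (2 ^ t <= #|I|)%N -> mlrep g I = 0.
  by move=> leI; apply: (deg_leP degg); apply: leq_trans leI.
move=> /(_ c0).
rewrite (eq_bigl xpredT) => [|Y]; last by rewrite subsetT.
rewrite (reindex (@supp n)) /=; last first.
  by exists (@charvec n) => ? _; rewrite ?charvecK ?suppK.
rewrite (eq_bigr (fun x => sgnF2 R (elsym (2 ^ t)%N n x + g x))) => [|x _]; last first.
  rewrite sgnF2D -mleval_supp mleval_mlrep; congr (_ * _).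
  rewrite /phi /sgnF2 elsym_supp -(dvdn_pcharf (pchar_Fp (isT : prime 2))).
  by rewrite dvdn2 negbK.
rewrite sum_sgnF2D /Pr setTI cardsT card_rV_F2 => /(le_trans (ler_norm _)).
rewrite lerBlDr natrX -lerBlDl => le2.
rewrite ler_pdivlMr ?exprn_gt0 ?ltr0n //.
have : (0 : R) < 2 ^+ n by rewrite exprn_gt0 // ltr0n.
by nra.
Qed.

(** * Gram determinants over F_2 *)

(** Cauchy-Binet before grouping: [s] runs over all maps, and those that are not injective repeat a
    row of [B], so that their determinant is 0. *)
Lemma det_mulmx_sum (R : comNzRingType) q n (A : 'M[R]_(q, n)) (B : 'M[R]_(n, q)) :
  \det (A *m B) =
  \sum_(s : {ffun 'I_q -> 'I_n}) (\prod_i A i (s i)) * \det (rowsub s B).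
Proof.
pose AB (u : 'S_q) i j := A i j * B j (u i).
transitivity (\sum_(f : {ffun 'I_q -> 'I_n}) \sum_(u : 'S_q)
    (-1) ^+ u * \prod_i AB u i (f i)).
  rewrite exchange_big; apply: eq_bigr => /= u _; rewrite -big_distrr /=.
  congr (_ * _); rewrite -(bigA_distr_bigA (AB u)) /=.
  by apply: eq_bigr => x _; rewrite mxE.
apply: eq_bigr => f _; rewrite big_distrr /=; apply: eq_bigr => u _.
rewrite mulrCA big_split //=; congr (_ * (_ * _)).
by apply: eq_bigr => x _; rewrite mxE.
Qed.

(* The permanent of the minor of M with column set I. *)
Definition perm_minor q n (M : 'M['F_2]_(q, n)) (I : {set 'I_n}) : 'F_2 :=
  \sum_(s : {ffun 'I_q -> 'I_n} | injectiveb s && ([set s i | i in 'I_q] == I))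
    \prod_i M i (s i).

(** Signs are trivial in ['F_2], so the determinant is a permanent, and the injections with the same
    image as [s] are the composites of [s] with permutations. Hence the minor depends only on the
    column set. *)
Lemma det_colsub_perm_minor q n (M : 'M['F_2]_(q, n)) (s : {ffun 'I_q -> 'I_n}) :
  injective s -> \det (colsub s M) = perm_minor M [set s i | i in 'I_q].
Proof.
move=> injs; pose h (u : 'S_q) : {ffun 'I_q -> 'I_n} := [ffun i => s (u i)].
have injh : injective h.
  move=> u v /ffunP eqh; apply/permP => i; apply: injs.
  by have := eqh i; rewrite !ffunE.
have signF2 (b : bool) : (-1) ^+ b = 1 :> 'F_2 by case: b; apply/eqP.
transitivity (\sum_(u : 'S_q) \prod_i M i (h u i)).
  apply: eq_bigr => u _; rewrite signF2 mul1r; apply: eq_bigr => i _.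
  by rewrite mxE ffunE.
rewrite -(@big_imset _ _ _ _ _ h predT (fun s' => \prod_i M i (s' i))) /=; last first.
  by move=> u v _ _; apply: injh.
apply: eq_bigl => s'; apply/imsetP/andP => [[u _ ->]|[/injectiveP injs' /eqP ims']].
  split; first by apply/injectiveP => i j; rewrite !ffunE => /injs/perm_inj.
  apply/eqP/setP => x; apply/imsetP/imsetP => -[i _ ->].
    by exists (u i); rewrite ?ffunE.
  by exists (u^-1%g i); rewrite ?ffunE ?permKV.
have /fin_all_exists[f fP] : forall i, exists j, s j = s' i.
  move=> i; have : s' i \in [set s i | i in 'I_q] by rewrite -ims' imset_f.
  by case/imsetP => j _ ->; exists j.
have injf : injective f.
  by move=> i j eqf; apply: injs'; rewrite -!fP eqf.
by exists (perm injf) => //; apply/ffunP => i; rewrite ffunE permE fP.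
Qed.

Lemma det_gram_perm_minor q n (M : 'M['F_2]_(q, n)) :
  \det (M *m M^T) = \sum_(I : {set 'I_n} | #|I| == q) perm_minor M I.
Proof.
rewrite det_mulmx_sum.
rewrite (bigID (fun s : {ffun 'I_q -> 'I_n} => injectiveb s)) /= [X in _ + X]big1.
  rewrite addr0.
  rewrite (partition_big (fun s : {ffun 'I_q -> 'I_n} => [set s i | i in 'I_q])
    (fun I => #|I| == q)) /=; last first.
    by move=> s /injectiveP injs; rewrite card_imset // card_ord.
  apply: eq_bigr => I _.
  (* The maps with image [I] contribute the square of the minor, and every element of ['F_2] is its
     own square. *)
  transitivity (perm_minor M I * perm_minor M I); last first.
    by case: (F2_cases (perm_minor M I)) => ->; rewrite ?mulr0 ?mulr1.
  rewrite {1}/perm_minor mulr_suml; apply: eq_bigr => s /andP[/injectiveP injs /eqP imI].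
  congr (_ * _); rewrite -imI -(det_colsub_perm_minor M injs).
  by rewrite -det_tr; congr (\det _); apply/matrixP => i j; rewrite !mxE.
move=> s /injectiveP injs; apply/eqP; rewrite mulf_eq0; apply/orP; right.
have /injectivePn[i [j neij eqs]] : ~~ injectiveb s by apply/injectiveP.
by rewrite (determinant_alternate neij) // => k; rewrite !mxE eqs.
Qed.

(** If [u 0 i != 0], translation by [u] exchanges the two halves of the cube given by coordinate
    [i]; their sums agree and cancel in characteristic 2. *)
Lemma sum_translation_invariant n (F : 'rV['F_2]_n -> 'F_2) (u : 'rV['F_2]_n) :
  u != 0 -> (forall y, F (y + u) = F y) -> \sum_y F y = 0.
Proof.
case/rV0Pn => i ui invF.
rewrite (bigID (fun y : 'rV_n => y 0 i == 0)) /=.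
rewrite (reindex_inj (addIr u)) /=.
rewrite (eq_bigr _ (fun y _ => invF y)) (eq_bigl (fun y : 'rV_n => y 0 i != 0)).
  by rewrite addrr_pchar2 // pchar_Fp.
move=> y; rewrite mxE; move: ui.
by case: (F2_cases (u 0 i)) => -> //; case: (F2_cases (y 0 i)) => ->.
Qed.

(** An invertible [A] gives exactly one solution; otherwise translation by a kernel vector preserves
    the solutions, so their number is even. *)
Lemma sum_solutions_det q (A : 'M['F_2]_q) (c : 'rV['F_2]_q) :
  \sum_y (y *m A == c)%:R = \det A.
Proof.
have [uA|] := boolP (A \in unitmx).
  rewrite (bigD1 (c *m invmx A)) //= mulmxKV // eqxx big1 ?addr0.
    by move: uA; rewrite unitmxE; case: (F2_cases (\det A)) => ->.
  move=> y ney; case: eqP => // eqc; case/eqP: ney.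
  by rewrite -eqc mulmxK.
rewrite unitmxE unitfE negbK => /eqP detA; rewrite detA.
have /eqP/det0P[u nzu uA] := detA.
by apply: (sum_translation_invariant nzu) => y; rewrite mulmxDl uA addr0.
Qed.

(** With [p = (b, M)], the monomial of [I] is 1 at [b + y M] exactly when [y M_I = 1 + b_I]; the
    parity of the number of such [y] is the minor on [I], whatever the right-hand side. *)
Lemma sum_affmap_elsym q n (p : 'rV['F_2]_n * 'M['F_2]_(q, n)) :
  \sum_y elsym q n (affmap p y) = \det (p.2 *m p.2^T).
Proof.
rewrite det_gram_perm_minor.
under eq_bigr do rewrite ffunE.
rewrite exchange_big /=; apply: eq_bigr => I /eqP cI.
have [s injs imI] : exists2 s : {ffun 'I_q -> 'I_n},
    injective s & [set s i | i in 'I_q] = I.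
  exists [ffun i : 'I_q => enum_val (cast_ord (esym cI) i)].
    by move=> i j; rewrite !ffunE => /enum_val_inj/cast_ord_inj.
  apply/setP => x; apply/imsetP/idP => [[i _ ->]|xI]; first by rewrite ffunE enum_valP.
  exists (cast_ord cI (enum_rank_in xI x)) => //.
  by rewrite ffunE cast_ordK enum_rankK_in.
rewrite -imI -det_colsub_perm_minor //.
rewrite -(sum_solutions_det _ (const_mx 1 + colsub s p.1)); apply: eq_bigr => y _.
rewrite big_imset /=; last by move=> i j _ _; apply: injs.
have -> : \prod_(i in 'I_q) affmap p y 0 (s i) =
    (colsub s (affmap p y) == const_mx 1)%:R.
  case: eqP => [/matrixP eq1|ne1].
    by rewrite big1 // => i _; have := eq1 0 i; rewrite !mxE.
  have [//|/prodf_neq0 nz] := eqVneq (\prod_(i in 'I_q) affmap p y 0 (s i)) 0.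
  case: ne1; apply/rowP => i; rewrite [LHS]mxE [RHS]mxE.
  by have := nz i isT; case: (F2_cases (affmap p y 0 (s i))) => ->.
congr (nat_of_bool _)%:R; rewrite mulmx_colsub.
have -> : colsub s (affmap p y) = colsub s p.1 + colsub s (y *m p.2).
  by apply/matrixP => i j; rewrite !mxE.
rewrite -[LHS](inj_eq (addIr (colsub s p.1))); congr (_ == _).
apply/matrixP => i j; rewrite !mxE addrAC addrr_pchar2 ?add0r // pchar_Fp //.
Qed.

Definition gdet q n (M : 'M['F_2]_(q, n)) : 'F_2 := \det (M *m M^T).

(** Although [M] occurs twice in the Gram matrix, each of its rows enters each product here exactly
    once; this is the source of additivity in the rows. *)
Lemma gdet_inj_sum q n (M : 'M['F_2]_(q, n)) :
  gdet M = \sum_(s : {ffun 'I_q -> 'I_n} | injectiveb s) \prod_i M i (s i).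
Proof.
rewrite /gdet det_gram_perm_minor.
rewrite [RHS](partition_big (fun s : {ffun 'I_q -> 'I_n} => [set s i | i in 'I_q])
  (fun I => #|I| == q)) //= => s /injectiveP injs.
by rewrite card_imset // card_ord.
Qed.

Lemma gdet_last_row_additive q n (N : 'M['F_2]_(q, n)) :
  {morph (fun x : 'rV_n => gdet (col_mx N x)) : x y / x + y}.
Proof.
move=> x y; rewrite !gdet_inj_sum -big_split; apply: eq_bigr => s _ /=.
have E (z : 'rV_n) : \prod_i col_mx N z i (s i) =
    (\prod_i N i (s (lshift 1 i))) * z 0 (s (rshift q 0)).
  rewrite big_split_ord big_ord1 col_mxEd; congr (_ * _).
  by apply: eq_bigr => i _; rewrite col_mxEu.
by rewrite !E mxE mulrDr.
Qed.

Lemma gdet0P q n (M : 'M['F_2]_(q, n)) :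
  reflect (exists2 v : 'rV_q, v != 0 & v *m M *m M^T = 0) (gdet M == 0).
Proof.
rewrite /gdet; apply: (iffP det0P) => -[v nzv vM]; exists v => //; last by rewrite mulmxA.
by rewrite -mulmxA.
Qed.

(* u is a kernel vector of the Gram matrix of N and u_i = 1.  A kernel vector of
   the Gram matrix of (row' i N; y), extended by 0 at i, is independent of u, so
   the Gram matrix of (N; y) has corank at least 2; some nonzero combination of
   the two vectors then also annihilates the column coming from x. *)
Lemma gdet0_extend m n (N : 'M['F_2]_(m, n)) : gdet N = 0 ->
  exists (u : 'rV_m) (i : 'I_m), forall y : 'rV_n,
    u *m N *m y^T = 0 -> gdet (col_mx (row' i N) y) = 0 ->
    forall x : 'rV_n, gdet (col_mx (col_mx N y) x) = 0.
Proof.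
move=> /eqP/gdet0P[u nzu uN]; have [i ui] := rV0Pn _ nzu.
exists u, i => y zy /eqP/gdet0P[w nzw wM] x.
have ui1 : u 0 i = 1 by move: ui; case: (F2_cases (u 0 i)) => ->.
(* [E *m N] deletes row [i] of [N], while [v *m E] inserts a zero coordinate at [i] into [v]; the
   latter turns [w] into [b]. *)
pose E : 'M['F_2]_(m.-1, m) := row' i 1%:M.
have rowE : row' i N = E *m N by rewrite /E -{1}(mul1mx N) !row'Esub mul_rowsub_mx.
pose a := row_mx u (0 : 'rV_1); pose b := row_mx (lsubmx w *m E) (rsubmx w).
have aE : a *m col_mx N y = u *m N by rewrite mul_row_col mul0mx addr0.
have bE : b *m col_mx N y = w *m col_mx (row' i N) y.
  by rewrite -{1}(hsubmxK w) /b !mul_row_col rowE mulmxA.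
pose r := w *m col_mx (row' i N) y.
have [rN' ry] : r *m (row' i N)^T = 0 /\ r *m y^T = 0.
  move: wM; rewrite tr_col_mx mul_mx_row -/r -row_mx0 => /eq_row_mx //.
have Nz : N *m (u *m N)^T = 0.
  by apply: trmx_inj; rewrite trmx_mul trmxK uN trmx0.
have yz : y *m (u *m N)^T = 0.
  by apply: trmx_inj; rewrite trmx_mul trmxK zy trmx0.
have rz : r *m (u *m N)^T = 0.
  by rewrite -mulmxA mul_col_mx rowE -mulmxA Nz yz mulmx0 col_mx0 mulmx0.
(* [r] is orthogonal to all rows of [N] except possibly row [i], and to [u *m N]; since [u 0 i = 1],
   it is orthogonal to row [i] as well. *)
have rN : r *m N^T = 0.
  apply/rowP => j; rewrite [RHS]mxE.
  have rNj l : l != i -> (r *m N^T) 0 l = 0.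
    case: (unliftP i l) => [l' ->|->]; last by rewrite eqxx.
    move=> _; have /rowP/(_ l') := rN'; rewrite !mxE => {2}<-.
    by apply: eq_bigr => j1 _; rewrite !mxE.
  have [->|/rNj //] := eqVneq j i.
  have : (r *m (u *m N)^T) 0 0 = 0 by rewrite rz mxE.
  rewrite trmx_mul mulmxA mxE (bigD1 i) //= big1 => [|l /rNj ->]; last by rewrite mul0r.
  by rewrite addr0 [_^T _ _]mxE ui1 mulr1.
have bi : b 0 (lshift 1 i) = 0.
  rewrite row_mxEl mxE big1 // => l _; rewrite !mxE.
  by rewrite eq_sym (negbTE (neq_lift i l)) mulr0.
have ai : a 0 (lshift 1 i) = 1 by rewrite row_mxEl.
have nzb : b != 0.
  apply: contraNneq nzw => b0; move: b0; rewrite -row_mx0 => /eq_row_mx[wE w2].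
  rewrite -(hsubmxK w) w2 (_ : lsubmx w = 0) ?row_mx0 //.
  apply/rowP => l; have /rowP/(_ (lift i l)) := wE; rewrite !mxE (bigD1 l) //= big1.
    by rewrite !mxE eqxx mulr1 addr0.
  move=> l' nel; rewrite !mxE (inj_eq lift_inj) (negbTE nel) mulr0 //.
have aG : a *m col_mx N y *m (col_mx N y)^T = 0.
  by rewrite aE tr_col_mx mul_mx_row uN zy row_mx0.
have bG : b *m col_mx N y *m (col_mx N y)^T = 0.
  by rewrite bE tr_col_mx mul_mx_row -/r rN ry row_mx0.
have ext (c : 'rV_(m + 1)) : c != 0 -> c *m col_mx N y *m (col_mx N y)^T = 0 ->
    (c *m col_mx N y *m x^T) 0 0 = 0 -> gdet (col_mx (col_mx N y) x) = 0.
  move=> nzc cG cx; apply/eqP/gdet0P; exists (row_mx c 0).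
    by apply: contraNneq nzc; rewrite -row_mx0 => /eq_row_mx[->].
  rewrite mul_row_col mul0mx addr0 [(col_mx (col_mx N y) x)^T]tr_col_mx mul_mx_row cG.
  rewrite (_ : _ *m x^T = 0) ?row_mx0 //.
  by apply/matrixP => i' j'; rewrite !ord1 cx mxE.
have nza : a != 0 by apply/eqP => a0; move: ai; rewrite a0 mxE.
case: (F2_cases ((a *m col_mx N y *m x^T) 0 0)) => ax; first exact: (ext a).
case: (F2_cases ((b *m col_mx N y *m x^T) 0 0)) => bx; first exact: (ext b).
apply: (ext (a + b)).
- by apply/eqP => /rowP/(_ (lshift 1 i)); rewrite mxE ai bi mxE.
- by rewrite !mulmxDl aG bG addr0.
- by rewrite !mulmxDl mxE ax bx; apply/eqP.
Qed.

(** * Counting matrices by their Gram determinant *)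

Lemma leq_card_kernel (U V : finZmodType) (f : U -> V) :
  {morph f : x y / x + y} -> (#|U| <= #|V| * #|[set x | f x == 0%R]|)%N.
Proof.
move=> fD; rewrite -[X in (X <= _)%N]sum1_card (partition_big f predT) //=.
rewrite -sum_nat_const.
apply: leq_sum => v _; rewrite sum1_card.
have [/existsP[x0 /eqP fx0]|/existsPn no] := boolP [exists x, f x == v]; last first.
  by rewrite eq_card0 // => x; apply/negbTE/no.
(* Subtracting [x0] maps the fibre of [v] injectively into the kernel. *)
rewrite -(card_imset _ (addIr (- x0))) subset_leq_card //.
apply/subsetP => _ /imsetP[x /eqP fx ->]; rewrite inE.
have := fD (x - x0) x0; rewrite subrK fx fx0 => /eqP.
by rewrite -{1}[v]add0r (inj_eq (addIr _)) eq_sym.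
Qed.

Lemma card_col_mx m n (P : pred 'M['F_2]_(m + 1, n)) :
  #|[set M | P M]| =
  (\sum_(N : 'M_(m, n)) #|[set x : 'rV_n | P (col_mx N x)]|)%N.
Proof.
rewrite -sum1_card (eq_bigr (fun N : 'M['F_2]_(m, n) =>
  \sum_(x : 'rV_n | P (col_mx N x)) 1)%N) => [|N _]; last first.
  by rewrite -sum1_card; apply: eq_bigl => x; rewrite inE.
rewrite pair_big_dep /= (reindex (fun p : 'M_(m, n) * 'rV_n => col_mx p.1 p.2)) /=.
  by apply: eq_bigl => -[N x]; rewrite inE.
exists (fun M => (usubmx M, dsubmx M)) => [[N x] _|M _] /=.
  by rewrite col_mxKu col_mxKd.
by rewrite vsubmxK.
Qed.

Lemma card_mx_F2 m n : #|{: 'M['F_2]_(m, n)}| = (2 ^ (m * n))%N.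
Proof. by rewrite card_mx card_Fp. Qed.

Lemma card_gdet_neq0 k n :
  (16 * #|[set M : 'M['F_2]_(k + 1 + 1 + 1, n) | gdet M != 0%R]| <=
   7 * 2 ^ ((k + 1 + 1 + 1) * n))%N.
Proof.
have half m (N : 'M['F_2]_(m, n)) :
    (2 ^ n <= 2 * #|[set x : 'rV_n | gdet (col_mx N x) == 0%R]|)%N.
  rewrite -{1}card_rV_F2.
  apply: leq_trans (leq_card_kernel (@gdet_last_row_additive _ _ N)) _.
  by rewrite card_Fp.
pose good (M : 'M['F_2]_(k + 1 + 1, n)) :=
  [forall x : 'rV_n, gdet (col_mx M x) == 0].
(* With [k + 1] rows there is a last row, so [half] applies to it. *)
have s0 : (2 ^ ((k + 1) * n) <= 2 * #|[set N : 'M['F_2]_(k + 1, n) | gdet N == 0%R]|)%N.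
  rewrite (card_col_mx (fun N => gdet N == 0)) big_distrr /= mulnDl mul1n expnD.
  rewrite -{1}card_mx_F2 -sum_nat_const; apply: leq_sum => N _; exact: half.
have s1 : (2 ^ n * #|[set N : 'M['F_2]_(k + 1, n) | gdet N == 0%R]| <=
    4 * #|[set M | good M]|)%N.
  rewrite card_col_mx big_distrr /= mulnC -sum_nat_const big_mkcond /=.
  apply: leq_sum => N _; case: ifP => //; rewrite inE => /eqP.
  move=> /gdet0_extend[u [i Hy]].
  (* The two conditions of [gdet0_extend] form one additive map into a group of order 4, so at least
     a quarter of all [y] satisfy both. *)
  pose f (y : 'rV['F_2]_n) : 'rV['F_2]_(1 + 1) :=
    row_mx (u *m N *m y^T) (gdet (col_mx (row' i N) y))%:M.
  have fD : {morph f : x y / x + y}.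
    move=> x y; rewrite /f gdet_last_row_additive add_row_mx; congr row_mx.
      by rewrite [(x + y)^T]raddfD /= mulmxDr.
    by rewrite raddfD.
  rewrite -{1}card_rV_F2; apply: leq_trans (leq_card_kernel fD) _.
  rewrite card_rV_F2 leq_mul2l /=; apply/subset_leq_card/subsetP => y.
  rewrite !inE -row_mx0 => /eqP/eq_row_mx[fy1 fy2]; apply/forallP => x; apply/eqP.
  by apply: Hy => //; have /matrixP/(_ 0 0) := fy2; rewrite !mxE eqxx mulr1n.
have s2 : (2 * #|[set M : 'M['F_2]_(k + 1 + 1 + 1, n) | gdet M != 0%R]| <=
    2 ^ n * #|[set M | ~~ good M]|)%N.
  rewrite (card_col_mx (fun M => gdet M != 0)) big_distrr /= mulnC.
  rewrite -sum_nat_const [leqRHS]big_mkcond /=.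
  apply: leq_sum => M _; rewrite inE; case: ifPn => [_|]; last first.
    rewrite negbK => /forallP gM; rewrite leqn0 muln_eq0 /= cards_eq0.
    by apply/eqP/setP => x; rewrite !inE gM.
  have := half _ M; have := cardsC [set x : 'rV_n | gdet (col_mx M x) == 0%R].
  rewrite card_rV_F2 (_ : ~: _ = [set x | gdet (col_mx M x) != 0]); last first.
    by apply/setP => x; rewrite !inE.
  by move=> <-; rewrite !mul2n -!addnn leq_add2l leq_add2r.
have := cardsC [set M | good M]; rewrite card_mx_F2.
rewrite (_ : ~: _ = [set M | ~~ good M]); last by apply/setP => x; rewrite !inE.
have -> : (2 ^ ((k + 1 + 1 + 1) * n) = 2 ^ n * (2 ^ n * 2 ^ ((k + 1) * n)))%N.
  by rewrite -!expnD; congr (_ ^ _)%N; lia.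
have -> : (2 ^ ((k + 1 + 1) * n) = 2 ^ n * 2 ^ ((k + 1) * n))%N.
  by rewrite -!expnD; congr (_ ^ _)%N; lia.
(* The factors are 1/2 in [s0], 1/4 in [s1] and 1/2 in [s2], whence (1 - 1/8) / 2 = 7/16. *)
by move: s0 s1 s2; nia.
Qed.

(** * Affine subspaces *)

(** A monomial missing a variable is invariant under flipping it, so its sum over the cube is 0; the
    full monomial is 1 only at the all-ones point. *)
Lemma sum_mleval n (c : mlpoly n) : \sum_y mleval c y = c setT.
Proof.
under eq_bigr do rewrite ffunE.
rewrite exchange_big /= (bigD1 setT) //= [X in _ + X]big1 ?addr0 => [|I neI].
  rewrite -mulr_sumr (bigD1 (const_mx 1)) //= big1 => [|i _]; last by rewrite mxE.
  rewrite big1 ?addr0 ?mulr1 // => y ney; rewrite prod_suppE subTset.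
  case: eqP => // sT; case/eqP: ney; rewrite -[y]suppK sT.
  by apply/rowP => i; rewrite !mxE inE.
rewrite -mulr_sumr.
have /subsetPn[i _ iI] : ~~ ([set: 'I_n] \subset I) by rewrite subTset.
rewrite (@sum_translation_invariant _ _ (delta_mx 0 i)) ?mulr0 //.
  by apply/eqP => /rowP/(_ i); rewrite !mxE !eqxx.
move=> y; apply: eq_bigr => j jI; rewrite !mxE eqxx /=.
by case: eqP jI iI => [->|_ _ _]; [move=> -> | rewrite addr0].
Qed.

(** Only the full set has more than [d] elements, and its coefficient is the sum of [g]. *)
Lemma deg_le_of_sum0 d (g : boolfun (d + 1)) : \sum_y g y = 0 -> (deg g <= d)%N.
Proof.
rewrite -{1}(mleval_mlrep g) sum_mleval => gT.
apply/bigmax_leqP => I nz; rewrite leqNgt; apply/negP => ltI.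
case/eqP: nz; rewrite -gT; congr (mlrep g _); apply/eqP.
by rewrite eqEcard subsetT cardsT card_ord /=; apply: leq_trans ltI; rewrite addn1.
Qed.

Lemma affmap_inj k n (p : 'rV['F_2]_n * 'M['F_2]_(k, n)) :
  row_free p.2 -> injective (affmap p).
Proof. by move=> rf x y /addrI/(row_free_inj rf). Qed.

Lemma sum_parametrizes k n (f : boolfun n) p (A : {set 'rV['F_2]_n}) :
  @parametrizes k n p A -> \sum_y f (affmap p y) = \sum_(a in A) f a.
Proof.
case/andP=> rf /eqP ->; rewrite big_imset //= => x y _ _.
exact: affmap_inj.
Qed.

Definition reparam k n (p : 'rV['F_2]_n * 'M['F_2]_(k, n))
    (s : 'rV['F_2]_k * 'M['F_2]_k) : 'rV['F_2]_n * 'M['F_2]_(k, n) :=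
  (affmap p s.1, s.2 *m p.2).

Lemma affmap_reparam k n (p : 'rV['F_2]_n * 'M['F_2]_(k, n)) s y :
  affmap (reparam p s) y = affmap p (affmap s y).
Proof. by rewrite /affmap /= mulmxDl mulmxA addrA. Qed.

(** Through [reparam], the invertible affine maps of the parameter space correspond bijectively to
    the parametrizations of [A], whose number is therefore the same for every [A]. *)
Lemma card_parametrizes k n p0 (A : {set 'rV['F_2]_n}) : @parametrizes k n p0 A ->
  #|[set p | @parametrizes k n p A]| =
  #|[set s : 'rV['F_2]_k * 'M['F_2]_k | row_free s.2]|.
Proof.
case/andP=> rf0 /eqP defA.
rewrite -[RHS](@card_imset _ _ (reparam p0)); last first.
  move=> [c P] [c' P'] /eqP; rewrite xpair_eqE /=.
  by move=> /andP[/eqP/(affmap_inj rf0) -> /eqP/(row_free_inj rf0) ->].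
apply: eq_card => p; rewrite inE; apply/idP/imsetP => [/andP[rf /eqP defA']|].
  have /fin_all_exists[s sP] (y : 'rV_k) : exists z, affmap p0 z = affmap p y.
    have : affmap p y \in A by rewrite defA' imset_f.
    by rewrite defA => /imsetP[z _ ->]; exists z.
  pose P : 'M['F_2]_k := \matrix_i (s (delta_mx 0 i) - s 0).
  have defP : P *m p0.2 = p.2.
    apply/row_matrixP => i; rewrite row_mul rowK mulmxBl rowE.
    have := sP (delta_mx 0 i); have := sP 0; rewrite /affmap mul0mx addr0 => <-.
    by rewrite -addrA => /addrI ->; rewrite addrAC subrr add0r.
  exists (s 0, P); last first.
    by rewrite /reparam /= defP sP /affmap mul0mx addr0 -surjective_pairing.
  rewrite inE /= -row_leq_rank (leq_trans _ (mxrankM_maxl P p0.2)) //.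
  by rewrite defP row_leq_rank.
case=> s; rewrite inE => rfs ->; apply/andP; split.
  by rewrite /row_free /= mxrankMfree.
rewrite defA; apply/eqP/setP => x; apply/imsetP/imsetP => -[y _ ->].
  exists (invF (affmap_inj rfs) y) => //.
  by rewrite affmap_reparam f_invF.
by exists (affmap s y) => //; rewrite affmap_reparam.
Qed.

(** Double counting of pairs [(A, p)]: every [A] has equally many parametrizations, while [p] can
    parametrize only its own image. This passes from subspaces to matrices. *)
Lemma card_bound_parametrizes k n (S : {set {set 'rV['F_2]_n}})
    (Q : pred ('rV['F_2]_n * 'M['F_2]_(k, n))) :
  (forall A, A \in S -> A \in affine_subspaces k n) ->
  (forall A p, A \in S -> parametrizes p A -> Q p) ->
  (#|S| * #|[set s : 'rV['F_2]_k * 'M['F_2]_k | row_free s.2]| <=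
   #|[set p | Q p]|)%N.
Proof.
move=> affS SQ; rewrite -sum_nat_const.
apply: (@leq_trans (\sum_(A in S) \sum_(p | Q p && parametrizes p A) 1)%N).
  apply: leq_sum => A AS; have := affS A AS; rewrite inE => /existsP[p0 pA].
  rewrite -(card_parametrizes pA) -sum1_card; apply/eq_leq/eq_bigl => p.
  by rewrite inE; case: (boolP (parametrizes p A)) => [/(SQ _ _ AS) ->|]; rewrite ?andbF.
rewrite (exchange_big_dep Q) /= => [|A p _ /andP[] //].
rewrite -sum1dep_card.
apply: leq_sum => p Qp; rewrite sum1_card.
rewrite -[X in (_ <= X)%N](cards1 [set affmap p y | y : 'rV['F_2]_k]).
apply/subset_leq_card/subsetP => A.
by rewrite !inE => /andP[_ /andP[_ /andP[_ ]]].
Qed.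

Lemma card_affine_subspaces k n :
  (#|affine_subspaces k n| * #|[set s : 'rV['F_2]_k * 'M['F_2]_k | row_free s.2]| =
   #|[set p : 'rV['F_2]_n * 'M['F_2]_(k, n) | row_free p.2]|)%N.
Proof.
rewrite -sum_nat_const -[RHS]sum1dep_card.
rewrite [RHS](partition_big (fun p : 'rV['F_2]_n * 'M['F_2]_(k, n) =>
  [set affmap p y | y : 'rV['F_2]_k]) [in affine_subspaces k n]) /=; last first.
  move=> p; rewrite !inE => rf; apply/existsP; exists p.
  by rewrite /parametrizes rf eqxx.
apply: eq_bigr => A; rewrite inE => /existsP[p0 pA].
rewrite -(card_parametrizes pA) -sum1_card; apply: eq_bigl => p.
by rewrite !inE /parametrizes [A == _]eq_sym.
Qed.

(** Union bound over the nonzero [u] with [u *m M = 0]: a row of [M] where [u] is nonzero is then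
    determined by the other [q.-1] rows. *)
Lemma card_not_row_free q n :
  (#|[set M : 'M['F_2]_(q, n) | ~~ row_free M]| <= 2 ^ q * 2 ^ (q.-1 * n))%N.
Proof.
rewrite -card_rV_F2 -sum_nat_const -[X in (X <= _)%N]sum1dep_card.
apply: (@leq_trans (\sum_(M : 'M['F_2]_(q, n))
    \sum_(u : 'rV['F_2]_q | (u != 0%R) && (u *m M == 0%R)) 1)%N).
  rewrite big_mkcond; apply: leq_sum => M _.
  case: ifP => //; rewrite -kermx_eq0 => /rowV0Pn[u uM nzu].
  by rewrite (bigD1 u) //= nzu; apply/eqP/sub_kermxP.
rewrite (exchange_big_dep predT) //=; apply: leq_sum => u _.
have [->|/rV0Pn[i ui]] := eqVneq u 0; first by rewrite big_pred0.
rewrite sum1_card -card_mx_F2.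
rewrite -(@card_in_imset _ _ (fun M : 'M['F_2]_(q, n) => row' i M)) ?max_card //.
move=> M N M0 N0 eqMN.
have [/eqP uM /eqP uN] : u *m M == 0 /\ u *m N == 0 by split; [exact: M0|exact: N0].
apply/row_matrixP => j.
have rowMN l : l != i -> row l M = row l N.
  case: (unliftP i l) => [l' -> _|->]; last by rewrite eqxx.
  by have /(congr1 (row l')) := eqMN; rewrite !row_rowsub.
have [->|/rowMN //] := eqVneq j i.
have : u *m M = u *m N by rewrite uM uN.
rewrite !mulmx_sum_row (bigD1 i) //= [in RHS](bigD1 i) //=.
rewrite (eq_bigr (fun l => u 0 l *: row l N)) => [/addIr|l /rowMN -> //].
exact: scalerI.
Qed.

(** Of all matrices, at most 7/16 have nonzero Gram determinant and at least 15/16 have full row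
    rank. Hence at most 7/15 of the subspaces reject, and 7/15 is below 63/128 = 1/2 - 2^-7. *)
Lemma Rej_elsym_le (R : realType) d n : (2 <= d)%N -> (d + 1 + 4 <= n)%N ->
  Rej R d (d + 1)%N (elsym (d + 1)%N n) <= 1 / 2 - 2 ^- 7.
Proof.
move=> le2d len; set q := (d + 1)%N.
rewrite /Rej /Pr; set S := _ :&: _.
set K := #|[set s : 'rV['F_2]_q * 'M['F_2]_q | row_free s.2]|.
set rf := #|[set M : 'M['F_2]_(q, n) | row_free M]|.
set gd := #|[set M : 'M['F_2]_(q, n) | gdet M != 0]|.
have prodE (P : pred 'M['F_2]_(q, n)) :
    #|[set p : 'rV['F_2]_n * 'M['F_2]_(q, n) | P p.2]| = (2 ^ n * #|[set M | P M]|)%N.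
  rewrite -card_rV_F2 -cardsT -cardsX; apply: eq_card => p.
  by rewrite !inE.
have allE : (#|affine_subspaces q n| * K = 2 ^ n * rf)%N.
  by rewrite card_affine_subspaces (prodE (fun M => row_free M)).
have badE : (#|S| * K <= 2 ^ n * gd)%N.
  rewrite -(prodE (fun M => gdet M != 0)); apply: card_bound_parametrizes => A.
    by rewrite inE => /andP[].
  (* Rejection is witnessed by some [p']; the sum of the values depends only on [A], so it is
     nonzero for the given [p] as well. *)
  move=> p; rewrite !inE => /andP[_ /forallPn[p']]; rewrite negb_imply -ltnNge.
  case/andP=> pA' degp' pA; rewrite /gdet -sum_affmap_elsym.
  rewrite (sum_parametrizes _ pA) -(sum_parametrizes _ pA').
  apply: contraTneq degp' => s0; rewrite -leqNgt; apply: deg_le_of_sum0.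
  by rewrite -[RHS]s0; apply: eq_bigr => y _; rewrite ffunE.
have rfE : (15 * 2 ^ (q * n) <= 16 * rf)%N.
  have arith a b c T : (16 * a <= T -> c <= a -> b + c = T -> 15 * T <= 16 * b)%N.
    by lia.
  (* The proportion of rank-deficient matrices is at most [2^q / 2^n], which is at most 1/16 as
     [q + 4 <= n]. *)
  apply: (arith _ _ _ _ _ (card_not_row_free q n)).
    rewrite -[16%N]/(2 ^ 4)%N -!expnD leq_exp2l //.
    by rewrite /q addn1 /= mulSn; lia.
  rewrite -card_mx_F2 -[RHS](cardsC [set M : 'M['F_2]_(q, n) | row_free M]).
  by congr addn; apply: eq_card => M; rewrite !inE.
have gdE : (16 * gd <= 7 * 2 ^ (q * n))%N.
  rewrite /gd /q; have -> : (d + 1 = (d - 2) + 1 + 1 + 1)%N by lia.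
  exact: card_gdet_neq0.
have T_gt0 : (0 < 2 ^ (q * n))%N by rewrite expn_gt0.
have n_gt0 : (0 < 2 ^ n)%N by rewrite expn_gt0.
have allK_gt0 : (0 < #|affine_subspaces q n| * K)%N.
  by rewrite allE muln_gt0 n_gt0; lia.
have [all_gt0 K_gt0] : (0 < #|affine_subspaces q n|)%N /\ (0 < K)%N.
  by apply/andP; rewrite -muln_gt0.
have : (128 * #|S| <= 63 * #|affine_subspaces q n|)%N.
  rewrite -(leq_pmul2r K_gt0) -!mulnA allE; nia.
rewrite -(ler_nat R) !natrM ler_pdivrMr ?ltr0n // => le63.
have -> : (1 / 2 - 2 ^- 7 : R) = 63 / 128 by field.
by lra.
Qed.

Theorem theorem24 (R : realType) (d t : nat) (ht : (2 <= t)%N)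
    (hd : (d + 1 = 2 ^ t)%N) (eps : R) (heps : 0 < eps) :
  exists n0 : nat, forall n : nat, (n0 <= n)%N ->
    1 / 2 - eps <= delta R d (elsym (d + 1)%N n) /\
    Rej R d (d + 1)%N (elsym (d + 1)%N n) <= 1 / 2 - 2 ^- 7 + eps.
Proof.
have ltd : (d < 2 ^ t)%N by rewrite -hd addn1.
have [N HN] := delta_elsym_ge ltd heps.
exists (maxn N (d + 1 + 4)) => n; rewrite geq_max => /andP[leN len]; split.
  by rewrite hd; apply: HN.
apply: le_trans (Rej_elsym_le R _ len) _; last by rewrite lerDl ltW.
(* Hence [d >= 3], enough for the three rows that the rejection bound splits off. *)
have : (2 ^ 2 <= 2 ^ t)%N by rewrite leq_exp2l.
by rewrite -hd; lia.
Qed.
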